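(* Let $R$ be a discrete valuation ring with maximal ideal generated by $p$, let $A$ be a reduced countably generated torsion $R$-module, let $n$ be a positive integer, and suppose that $A$ is annihilated by $p^k$ for a non-negative integer $k$. If $$\mathbf{a}^{(0)}\to\mathbf{a}^{(1)}\to\dotsb\to\mathbf{a}^{(m)}$$ is a chain of degenerations of $n$-tuples in $A$ with $m>nk(k+1)$, then there exists $i$ with $0<i\leq m$ such that $\mathbf{a}^{(i)}\to\mathbf{a}^{(i-1)}$.
   Context: A module is reduced if it has no nonzero divisible submodule. Degeneration: for $n$-tuples $\mathbf{a}=(a_1,\dotsc,a_n)$ and $\mathbf{b}=(b_1,\dotsc,b_n)$ in $A$, $\mathbf{a}\to\mathbf{b}$ means there is an $R$-module endomorphism $\phi$ of $A$ with $\phi(a_i)=b_i$ for $i=1,\dotsc,n$. *)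

(* Defs.v *)
From HB Require Import structures.
From mathcomp Require Import all_boot all_order all_algebra.
From mathcomp Require Import boolp classical_sets functions cardinality.

Set Implicit Arguments.
Unset Strict Implicit.
Unset Printing Implicit Defensive.

Import GRing.Theory.

Local Open Scope classical_set_scope.
Local Open Scope ring_scope.

Definition submodule (R : idomainType) (V : lmodType R) (S : set V) : Prop :=
  submod_closed [in S].

Definition ideal (R : idomainType) (I : set R) : Prop := @submodule R R^o I.

Definition principal (R : idomainType) (x : R) : set R := range (fun r => r * x).

Definition maximal_ideal (R : idomainType) (I : set R) : Prop :=
  [/\ ideal I, I <> [set: R] &
      forall J : set R, ideal J -> I `<=` J -> J = I \/ J = [set: R]].

(* A local principal ideal domain that is not a field. *)
Definition discrete_valuation_ring (R : idomainType) : Prop :=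
  [/\ forall I : set R, ideal I -> exists x : R, I = principal x,
      exists! M : set R, maximal_ideal M &
      exists x : R, x != 0 /\ x \isn't a GRing.unit].

Definition torsion_module (R : idomainType) (A : lmodType R) : Prop :=
  forall x : A, exists r : R, r != 0 /\ r *: x = 0.

Definition countably_generated (R : idomainType) (A : lmodType R) : Prop :=
  exists S : set A, countable S /\ smallest (@submodule R A) S = [set: A].

Definition divisible (R : idomainType) (A : lmodType R) (D : set A) : Prop :=
  forall (r : R) (x : A), r != 0 -> D x -> exists y : A, D y /\ x = r *: y.

Definition reduced (R : idomainType) (A : lmodType R) : Prop :=
  forall D : set A, submodule D -> divisible D -> D = [set 0].

Definition degenerates (R : idomainType) (A : lmodType R) (n : nat)
    (a b : n.-tuple A) : Prop :=
  exists phi : {linear A -> A}, forall i : 'I_n, phi (tnth a i) = tnth b i.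

(* Main.v *)
Require Import Defs.
From HB Require Import structures.
From mathcomp Require Import all_boot all_order all_algebra.
From mathcomp Require Import boolp classical_sets functions cardinality.

Import GRing.Theory.

Local Open Scope ring_scope.

(** Write [p^h A] for the elements of height at least [h]. For a tuple [a],
    consider the submodules
    [F_h(a) = {c in R^n | \sum_j c_j a_j lies in p^h A}] of [R^n].
    An endomorphism preserves each [p^h A], so [a -> b] forces
    [F_h(a) <= F_h(b)] for every [h]. The converse also holds
    ([degenerates_of_heights]): if [F_h(a) <= F_h(b)] for all [h], the
    assignment [a_j |-> b_j] is a well-defined homomorphism on the span of [a]
    which does not decrease heights, since [p^k A = 0] makes the case [h = k]
    say that relations are preserved; and such a homomorphism extends to [A]
    one element at a time by Kaplansky's argument
    ([height_preserving_graph_total]), because in a bounded module every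
    coset has an element of maximal height.

    A chain of degenerations is therefore an ascending chain of [k]-tuples
    [(F_1, ..., F_k)] of submodules of [R^n] containing [p^k R^n]. Such a
    submodule [F] is measured by its leading exponents: the pairs [(j, v)],
    [v < k], such that [F] contains a vector whose first nonzero entry is
    [p^v], in position [j]. As in Gaussian
    elimination, [F <= G] with the same leading exponents forces [F = G]
    ([lincomb_height_of_leading]). The resulting finite sets of triples
    [(h, j, v)] have at most [n k^2] elements, so a chain longer than that has
    two consecutive members with the same [F_h], and these degenerate to each
    other. *)

(** * Submodules and maximality *)

Lemma submoduleP {R : idomainType} {V : lmodType R} (S : set V) :
  submodule S <->
  S 0 /\ forall (c : R) (x y : V), S x -> S y -> S (c *: x + y).
Proof.
split=> [[S0 SD]|[S0 SD]].
  split=> [|c x y Sx Sy]; first by move: S0; rewrite inE.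
  by have := SD c x y; rewrite !inE; apply.
split=> [|c x y]; first by rewrite inE.
by rewrite !inE; apply: SD.
Qed.

(** Zorn's lemma for submodules contained in a prescribed set [Q]. *)
Lemma maximal_submodule {R : idomainType} {V : lmodType R} (Q S0 : set V) :
  submodule S0 -> (S0 `<=` Q)%classic ->
  exists M : set V, [/\ submodule M, (S0 `<=` M)%classic, (M `<=` Q)%classic &
    forall N : set V, submodule N -> (M `<=` N)%classic ->
      (N `<=` Q)%classic -> N = M].
Proof.
move=> /submoduleP [S00 S0D] S0Q.
(* The empty set is admitted because it is the union of the empty chain. *)
pose P (X : set V) := [/\ forall x y, X x -> S0 y -> X y,
  forall (c : R) x y, X x -> X y -> X (c *: x + y) & (X `<=` Q)%classic].
have PS0 : P S0 by split.
case: (@Zorn_bigcup V P) => [F FP Ftot|M [[MS0 MD MQ] Mmax]].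
  split=> [x y [X FX Xx] S0y|c x y [X FX Xx] [Y FY Yy]|x [X FX Xx]].
  - by exists X => //; have [+ _ _] := FP X FX; apply; eauto.
  - have [XY|YX] := Ftot X Y FX FY.
      by exists Y => //; have [_ + _] := FP Y FY; apply => //; exact: XY.
    by exists X => //; have [_ + _] := FP X FX; apply => //; exact: YX.
  - by have [_ _] := FP X FX; apply.
have M0 : M 0.
  have [[x Mx]|/forallNP Mempty] := pselect (exists x, M x).
    exact: MS0 Mx S00.
  exfalso; apply: (Mmax S0) PS0; split; first by move=> x /Mempty.
  by move=> /(_ 0 S00) /Mempty.
have S0M : (S0 `<=` M)%classic by move=> x; exact: MS0 M0.
exists M; split => //; first exact/submoduleP.
move=> N /submoduleP [N0 ND] MN NQ; apply: contrapT => NM.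
apply: (Mmax N); last by split => // x y _ /S0M /MN.
by split => // NM'; apply: NM; apply/seteqP.
Qed.

(** * Divisibility by the uniformizer *)

(** A non-unit lies in some maximal ideal, and [(p)] is the only one. *)
Lemma nonunit_dvd_uniformizer {R : idomainType} (p : R) :
  discrete_valuation_ring R -> maximal_ideal (principal p) ->
  forall r : R, r \isn't a GRing.unit -> exists c, r = c * p.
Proof.
move=> [_ [M0 [_ Muniq]] _] pmax r rNunit.
have [||M [/[dup] Mid /submoduleP [M0' MD] rM MQ Mmax]] :=
    @maximal_submodule R R^o [set x : R | x <> 1]%classic (principal r).
- apply/submoduleP; split; first by exists 0 => //; rewrite mul0r.
  move=> c _ _ [x _ <-] [y _ <-]; exists (c * x + y) => //=.
  by rewrite mulrDl -mulrA.
- move=> _ [c _ <-] cr1; move/negP: rNunit; apply.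
  by apply/unitrPr; exists c; rewrite mulrC.
have MT : M <> [set: R]%classic by move=> MT; apply: (MQ 1) => //; rewrite MT.
have : maximal_ideal M.
  split=> // J Jid MJ; have [J1|NJ1] := pselect (J 1).
    right; apply/seteqP; split=> // x _.
    have /submoduleP [J0 JD] := Jid.
    by have := JD x 1 0 J1 J0; rewrite addr0 /GRing.scale /= mulr1.
  by left; apply: Mmax => // x Jx x1; apply: NJ1; rewrite -x1.
move=> /Muniq M0M; move: pmax => /Muniq; rewrite M0M => Mp.
have : M r by apply: rM; exists 1 => //; rewrite mul1r.
by rewrite Mp => -[c _ <-]; exists c.
Qed.

Lemma uniformizer_decomp {R : idomainType} (p : R) :
  (forall r : R, r \isn't a GRing.unit -> exists c, r = c * p) ->
  forall (k : nat) (r : R), (exists c, r = c * p ^+ k) \/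
    exists (v : 'I_k) (u : R), u \is a GRing.unit /\ r = u * p ^+ v.
Proof.
move=> pP; elim=> [|k IHk] r.
  by left; exists r; rewrite expr0 mulr1.
have [[c ->]|[v [u [uU ->]]]] := IHk r; last first.
  by right; exists (widen_ord (leqnSn k) v), u.
have [cU|/pP [d ->]] := boolP (c \is a GRing.unit).
  by right; exists ord_max, c.
by left; exists d; rewrite -mulrA -exprS.
Qed.

(** * Heights and extension of homomorphisms *)

(** The submodule [p^h A]: the elements of height at least [h]. *)
Definition height_ge {R : idomainType} {A : lmodType R} (p : R) (h : nat) :
  set A := [set x | exists y, x = p ^+ h *: y]%classic.

Section Height.
Context {R : idomainType} {A : lmodType R} (p : R).
Implicit Types (x y : A) (c : R).

Lemma height_geD h c x y : height_ge p h x -> height_ge p h y ->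
  height_ge p h (c *: x + y).
Proof.
move=> [x' ->] [y' ->]; exists (c *: x' + y').
by rewrite scalerDr !scalerA mulrC.
Qed.

Lemma height_ge_0 x : height_ge p 0 x.
Proof. by exists x; rewrite expr0 scale1r. Qed.

Lemma height_ge0 h : height_ge p h (0 : A).
Proof. by exists 0; rewrite scaler0. Qed.

Lemma height_geZ h c x : height_ge p h x -> height_ge p h (c *: x).
Proof. by move=> hx; rewrite -[_ *: _]addr0; apply/height_geD/height_ge0. Qed.

Lemma height_ge_le h h' x : (h <= h')%N -> height_ge p h' x -> height_ge p h x.
Proof.
move=> hh' [y ->]; exists (p ^+ (h' - h) *: y).
by rewrite scalerA -exprD subnKC.
Qed.

End Height.

(** Pairs [(x, y)] such that [y] has at least the height of [x]. When [A] is
    bounded, a submodule of [A * A] inside this set is the graph of a partial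
    homomorphism, because [0] is the only element of large height. *)
Definition height_increasing {R : idomainType} {A : lmodType R} (p : R) :
  set (A * A) :=
  [set g | forall h, height_ge p h g.1 -> height_ge p h g.2]%classic.

(** Kaplansky's extension step: if [x] is outside the domain of a maximal
    partial homomorphism and [p x] is inside, one may take [x] of maximal
    height in its coset, and then send it to any [y] of at least that height
    with [p y] equal to the image of [p x]. *)
Lemma height_preserving_graph_total {R : idomainType} {A : lmodType R}
    (p : R) (k : nat) (M : set (A * A)) :
  (forall r : R, r \isn't a GRing.unit -> exists c, r = c * p) ->
  (forall x : A, p ^+ k *: x = 0) ->
  submodule M -> (M `<=` height_increasing p)%classic ->
  (forall N : set (A * A), submodule N -> (M `<=` N)%classic ->
      (N `<=` height_increasing p)%classic -> N = M) ->
  forall x : A, exists y, M (x, y).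
Proof.
move=> pP Ak /submoduleP [M0 MD] Mh Mmax x0; apply: contrapT => x0D.
pose D (x : A) := exists y, M (x, y).
have D0 : D 0 by exists 0.
have DD c u v : D u -> D v -> D (c *: u + v).
  by move=> [u' Mu] [v' Mv]; exists (c *: u' + v'); exact: MD Mu Mv.
have [x xD pxD] : exists2 x, ~ D x & D (p *: x).
  have exi : exists i, `[< D (p ^+ i *: x0) >].
    by exists k; apply/asboolP; rewrite Ak.
  case: (ex_minnP exi) => -[|i] /asboolP Di imin.
    by case: x0D; move: Di; rewrite expr0 scale1r.
  exists (p ^+ i *: x0); last by rewrite scalerA -exprS.
  by move=> /asboolP /imin; rewrite ltnn.
(* [z = x + d] has maximal height [r] in the coset of [x] modulo the domain. *)
have [r [z [zD pzD zr zmax]]] : exists r z, [/\ ~ D z, D (p *: z),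
    height_ge p r z &
    forall h e, D e -> height_ge p h (z + e) -> (h <= r)%N].
  have exh : exists h, `[< exists2 d, D d & height_ge p h (x + d) >].
    by exists 0%N; apply/asboolP; exists 0 => //; exact: height_ge_0.
  have bndh h : `[< exists2 d, D d & height_ge p h (x + d) >] -> (h <= k)%N.
    move=> /asboolP [d Dd xdh]; rewrite leqNgt; apply/negP => kh.
    have [y] := height_ge_le p _ _ _ (ltnW kh) xdh; rewrite Ak => xd0.
    apply: xD; move: (DD (-1) d 0 Dd D0).
    by rewrite scaleN1r addr0 -(addr0_eq xd0) opprK.
  case: (ex_maxnP exh bndh) => r /asboolP [d Dd xdr] rmax.
  exists r, (x + d); split => // [xdD||h e De].
  - apply: xD; move: (DD (-1) d (x + d) Dd xdD).
    by rewrite scaleN1r addrC addrK.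
  - by rewrite scalerDr addrC; exact: DD.
  - rewrite -addrA => xeh; apply: rmax; apply/asboolP.
    by exists (d + e) => //; rewrite -[d]scale1r; exact: DD.
have [w Mw] := pzD.
have [y yr wE] : exists2 y, height_ge p r y & w = p *: y.
  have [|t /= ->] := Mh _ Mw r.+1.
    by have [t ->] := zr; exists t; rewrite scalerA -exprS.
  by exists (p ^+ r *: t); [exists t | rewrite scalerA -exprS].
pose N : set (A * A) := [set g | exists u v c,
  M (u, v) /\ g = (u + c *: z, v + c *: y)]%classic.
have MN : (M `<=` N)%classic.
  by move=> [u v] Muv; exists u, v, 0; rewrite !scale0r !addr0.
have NM : N = M.
  apply: (Mmax N) => // [|_ [u [v [c [Muv ->]]]] h /= uh].
    apply/submoduleP; split; first by apply: (MN 0).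
    move=> c _ _ [u [v [d [Muv ->]]]] [u' [v' [d' [Muv' ->]]]].
    exists (c *: u + u'), (c *: v + v'), (c * d + d'); split.
      exact: MD c _ _ Muv Muv'.
    rewrite !scalerDl -!scalerA.
    by congr pair; rewrite /= scalerDr addrACA.
  (* If [p] divides [c], the pair already lies in [M]. If [c] is a unit,
     maximality of [r] gives [h <= r], so [z] and [y] do not matter. *)
  have [cU|/pP [d cE]] := boolP (c \is a GRing.unit); last first.
    apply: (Mh (u + c *: z, v + c *: y) _ h uh).
    rewrite cE -!scalerA -wE addrC [v + _]addrC.
    exact: MD d _ _ Mw Muv.
  have hr : (h <= r)%N.
    apply: zmax (c^-1 *: u) _ _.
      by rewrite -[_ *: _]addr0; apply: DD => //; exists v.
    by rewrite -[z]scale1r -(mulVr cU) -scalerA -scalerDr addrC; exact: height_geZ.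
  rewrite addrC; apply: height_geD; first exact: height_ge_le hr yr.
  apply: (Mh _ Muv h _); rewrite /= -(addrK (c *: z) u) addrC -scaleNr.
  by apply: height_geD => //; exact: height_ge_le hr zr.
apply: zD; exists y; rewrite -NM.
by exists 0, 0, 1; rewrite !scale1r !add0r.
Qed.

(** * Degenerations of tuples and heights of linear combinations *)

(** The combination of the entries of [a] with coefficients [c]; vectors of
    [R^n] are encoded as functions on ['I_n]. *)
Definition lincomb {R : idomainType} {A : lmodType R} {n : nat}
  (a : n.-tuple A) (c : 'I_n -> R) : A := \sum_(j < n) c j *: tnth a j.

Lemma lincombD {R : idomainType} {A : lmodType R} {n : nat}
    (a : n.-tuple A) (r : R) (c d : 'I_n -> R) :
  lincomb a (fun j => r * c j + d j) = r *: lincomb a c + lincomb a d.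
Proof.
rewrite scaler_sumr -big_split; apply: eq_bigr => j _.
by rewrite scalerDl scalerA.
Qed.

Lemma lincomb0 {R : idomainType} {A : lmodType R} {n : nat} (a : n.-tuple A) :
  lincomb a (fun=> 0) = 0.
Proof. by apply: big1 => j _; rewrite scale0r. Qed.

Lemma lincomb_single {R : idomainType} {A : lmodType R} {n : nat}
    (a : n.-tuple A) (r : R) (i : 'I_n) :
  lincomb a (fun j => if j == i then r else 0) = r *: tnth a i.
Proof.
rewrite /lincomb (bigD1 i) //= eqxx big1 ?addr0 // => j /negbTE ->.
by rewrite scale0r.
Qed.

Lemma degenerates_heights {R : idomainType} {A : lmodType R} {n : nat}
    (p : R) (a b : n.-tuple A) :
  degenerates a b ->
  forall h c, height_ge p h (lincomb a c) -> height_ge p h (lincomb b c).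
Proof.
move=> [phi phia] h c [y cy]; exists (phi y).
rewrite -linearZ -cy linear_sum; apply: eq_bigr => j _.
by rewrite linearZ_LR phia.
Qed.

Lemma degenerates_of_heights {R : idomainType} {A : lmodType R} {n : nat}
    (p : R) (k : nat) (a b : n.-tuple A) :
  (forall r : R, r \isn't a GRing.unit -> exists c, r = c * p) ->
  (forall x : A, p ^+ k *: x = 0) ->
  (forall h c, height_ge p h (lincomb a c) -> height_ge p h (lincomb b c)) ->
  degenerates a b.
Proof.
move=> pP Ak ab.
pose G : set (A * A) := [set g | exists c, g = (lincomb a c, lincomb b c)]%classic.
have [||M [Msub GM Mh Mmax]] := maximal_submodule (height_increasing p) G.
- apply/submoduleP; split; first by exists (fun=> 0); rewrite !lincomb0.
  move=> r _ _ [c ->] [d ->]; exists (fun j => r * c j + d j).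
  by rewrite !lincombD.
- by move=> _ [c ->] h; exact: ab.
have Mtot := height_preserving_graph_total p k M pP Ak Msub Mh Mmax.
have /submoduleP [M0 MD] := Msub.
(* Two images of the same element differ by an image of [0], which lies in
   [p^k A]. *)
have Mfun x y y' : M (x, y) -> M (x, y') -> y = y'.
  move=> Mxy Mxy'; have := MD (-1) _ _ Mxy Mxy'.
  rewrite /= => /Mh /(_ k) [|t] /=; first by rewrite scaleN1r addNr; exact: height_ge0.
  by rewrite Ak scaleN1r => /addr0_eq; rewrite opprK.
pose f x := xget 0 [set y | M (x, y)]%classic.
have fP x : M (x, f x).
  exact: (xgetPex (0 : A) (Mtot x)).
have flin : linear f.
  by move=> c x y; apply: Mfun (fP _) _; exact: MD c _ _ (fP x) (fP y).
pose phi : {linear A -> A} := HB.pack f (GRing.isLinear.Build R A A *:%R f flin).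
exists phi => i; apply: Mfun (fP _) (GM _ _).
exists (fun j => if j == i then 1 else 0).
by rewrite !lincomb_single !scale1r.
Qed.

(** * Leading exponents *)

(** The exponent [v] is leading in position [j] for the submodule of vectors
    [c] whose combination with [a] has height at least [h]. *)
Definition leading {R : idomainType} {A : lmodType R} {n : nat} (p : R)
    (a : n.-tuple A) (h : nat) (j : 'I_n) (v : nat) : Prop :=
  exists c : 'I_n -> R, [/\ forall i : 'I_n, (i < j)%N -> c i = 0,
    c j = p ^+ v & height_ge p h (lincomb a c)].

Lemma lincomb_height_of_leading {R : idomainType} {A : lmodType R} {n : nat}
    (p : R) (k h : nat) (a b : n.-tuple A) :
  (forall r : R, r \isn't a GRing.unit -> exists c, r = c * p) ->
  (forall x : A, p ^+ k *: x = 0) ->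
  (forall c, height_ge p h (lincomb a c) -> height_ge p h (lincomb b c)) ->
  (forall (j : 'I_n) (v : 'I_k), leading p b h j v -> leading p a h j v) ->
  forall c, height_ge p h (lincomb b c) -> height_ge p h (lincomb a c).
Proof.
move=> pP Ak ab ba.
(* Induction on the number [d] of trailing entries allowed to be nonzero. *)
suff main d : (d <= n)%N -> forall c : 'I_n -> R,
    (forall i : 'I_n, (i < n - d)%N -> c i = 0) ->
    height_ge p h (lincomb b c) -> height_ge p h (lincomb a c).
  by move=> c; apply: (main n) => // i; rewrite subnn.
elim: d => [_ c c0 _|d IHd dn c c0 bc].
  have -> : c = fun=> 0 by apply/funext => i; rewrite c0 // subn0.
  by rewrite lincomb0; exact: height_ge0.
have jn : (n - d.+1 < n)%N by rewrite ltn_subrL (leq_trans _ dn).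
pose j := Ordinal jn.
(* Clear the entry in position [j] using a vector [e] which is in the
   submodules of both [a] and [b]. *)
suff [r [e [e0 ce ae]]] : exists r (e : 'I_n -> R),
    [/\ forall i : 'I_n, (i < j)%N -> e i = 0, c j = r * e j &
        height_ge p h (lincomb a e)].
  have eD (t : n.-tuple A) : lincomb t c =
      r *: lincomb t e + lincomb t (fun i => (- r) * e i + c i).
    rewrite lincombD addrA -scalerDl subrr scale0r.
    by rewrite add0r.
  rewrite eD; apply: height_geD => //; apply: IHd; first exact: ltnW.
    move=> i; rewrite -(subnSK dn) ltnS leq_eqVlt => /orP [/eqP ij|ij].
      by rewrite (_ : i = j) ?ce ?mulNr ?addNr //; exact: val_inj.
    by rewrite e0 // c0 // mulr0 addr0.
  by rewrite lincombD; apply: height_geD => //; exact: ab.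
(* If [p^k] divides the entry, use [p^k] times a basis vector, on which
   [lincomb] vanishes; otherwise use a vector witnessing a leading exponent. *)
have [[r cE]|[v [u [uU cE]]]] := uniformizer_decomp p pP k (c j).
  exists r, (fun i => if i == j then p ^+ k else 0); split => [i ij||].
  - by case: eqP ij => // ->; rewrite ltnn.
  - by rewrite eqxx.
  - by rewrite lincomb_single Ak; exact: height_ge0.
have [|e [e0 ej ae]] := ba j v.
  exists (fun i => u^-1 * c i + 0); split => [i ij||].
  - by rewrite c0 // mulr0 addr0.
  - by rewrite cE mulKr // addr0.
  - by rewrite (lincombD b u^-1 c) lincomb0 addr0; exact: height_geZ.
by exists u, e; rewrite ej.
Qed.

Lemma ascending_sets_stall {T : finType} (m : nat) (f : nat -> {set T}) :
  (#|T| < m)%N -> (forall i, (i < m)%N -> f i \subset f i.+1) ->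
  exists2 i, (i < m)%N & f i = f i.+1.
Proof.
move=> Tm fS; apply: contrapT => fne.
suff fi i : (i <= m)%N -> (i <= #|f i|)%N.
  by have := leq_trans (fi m (leqnn m)) (max_card _); rewrite leqNgt Tm.
elim: i => // i IHi im; apply: leq_ltn_trans (IHi (ltnW im)) _.
apply: proper_card; rewrite finset.properEneq fS // andbT.
by apply/eqP => fE; apply: fne; exists i.
Qed.

Theorem theorem10 (R : idomainType) (p : R) (A : lmodType R) (n k m : nat)
    (a : nat -> n.-tuple A) :
  discrete_valuation_ring R ->
  maximal_ideal (principal p) ->
  reduced A ->
  countably_generated A ->
  torsion_module A ->
  (0 < n)%N ->
  (forall x : A, p ^+ k *: x = 0) ->
  (n * k * (k + 1) < m)%N ->
  (forall i : nat, (i < m)%N -> degenerates (a i) (a i.+1)) ->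
  exists i : nat, [/\ (0 < i)%N, (i <= m)%N & degenerates (a i) (a i.-1)].
Proof.
move=> dvrR pmax _ _ _ _ Ak nkm deg.
have pP := nonunit_dvd_uniformizer p dvrR pmax.
(* The heights that matter are [1, ..., k], hence the shift by one. *)
pose f i := finset (fun t : 'I_k * 'I_n * 'I_k =>
  `[< leading p (a i) t.1.1.+1 t.1.2 t.2 >]).
have [||i im fE] := ascending_sets_stall m f.
- rewrite !card_prod !card_ord; apply: leq_ltn_trans nkm.
  by rewrite (mulnC k n) leq_mul2l leq_addr orbT.
- move=> i im; apply/fintype.subsetP => t; rewrite !finset.inE => /asboolP.
  move=> [c [c0 cj ac]].
  apply/asboolP; exists c; split => //.
  exact: degenerates_heights (deg i im) _ _ ac.
exists i.+1; split => //; apply: (degenerates_of_heights p k) => // h c.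
have low h' : (h' <= k)%N -> height_ge p h' (lincomb (a i.+1) c) ->
    height_ge p h' (lincomb (a i) c).
  case: h' => [|h'] hk; first by move=> _; exact: height_ge_0.
  apply: (lincomb_height_of_leading p k _ (a i) (a i.+1) pP Ak).
    exact: degenerates_heights (deg i im) _.
  move=> j v /asboolP lead.
  have : (Ordinal hk, j, v) \in f i.+1 by rewrite inE.
  by rewrite -fE inE => /asboolP.
(* Height above [k] means being zero, which is already detected at [k]. *)
have [|kh ch] := leqP h k; first exact: low.
have [y ->] := low k (leqnn k) (height_ge_le p _ _ _ (ltnW kh) ch).
by rewrite Ak; exact: height_ge0.
Qed.
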